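(* Let $n>m\ge 2$ be integers and let $\mathcal{A}=\{A_1,\dots,A_m\}$ be a partition of $[n]=\{1,\dots,n\}$ into $m$ blocks. Then \[ \sum_{\emptyset\neq X\subseteq[n]}\frac{|\mathcal{A}^-(X)|}{\binom{n}{|X|}\,|X|}=m . \]
   Context: For $X\subseteq[n]$, the $\mathcal{A}$-lower approximation of $X$ is $\mathcal{A}^-(X)=\bigcup_{i:\,A_i\subseteq X}A_i$. Blocks of a partition are nonempty. *)

(* Defs.v *)
From mathcomp Require Import all_boot all_order all_algebra.

Set Implicit Arguments.
Unset Strict Implicit.
Unset Printing Implicit Defensive.

Definition lower_approx (T : finType) (P : {set {set T}}) (X : {set T}) :
    {set T} :=
  \bigcup_(A in P | A \subset X) A.

(* Main.v *)
Require Import Defs.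
From mathcomp Require Import all_boot all_order all_algebra.
From mathcomp Require Import ring.

Set Implicit Arguments.
Unset Strict Implicit.
Unset Printing Implicit Defensive.

Import Order.TTheory GRing.Theory Num.Theory.
Local Open Scope ring_scope.

(** The blocks contained in [X] are disjoint, so exchanging the sums over [X]
    and over the blocks reduces the theorem to the case of one block [A]: the
    sum of [a / ('C(n, k) * k)] over all [X] containing [A], with [a = #|A|] and
    [k = #|X|], is 1. There are ['C(n - a, k - a)] such [X] of size [k], together
    they contribute ['C(k - 1, a - 1) / 'C(n, a)], and the hockey-stick identity
    sums these to 1. *)

Lemma hockey_stick (b c : nat) :
  (\sum_(i < b.+1) 'C(i + c, c) = 'C((b + c).+1, c.+1))%N.
Proof.
elim: b => [|b IHb]; first by rewrite big_ord_recr big_ord0 /= !binn.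
by rewrite big_ord_recr /= IHb addSn [RHS]binS.
Qed.

Lemma big_subset_card (R : nzSemiRingType) (T : finType) (B : {set T})
    (f : nat -> R) :
  \sum_(Y : {set T} | Y \subset B) f #|Y|
    = \sum_(j < #|B|.+1) 'C(#|B|, j)%:R * f j.
Proof.
(* Group by size; [inord] is faithful here because [#|Y| <= #|B|]. *)
rewrite (partition_big (fun Y : {set T} => inord #|Y| : 'I_#|B|.+1) predT) //=.
apply: eq_bigr => j _.
have eqP_j (Y : {set T}) : (Y \subset B) && (inord #|Y| == j :> 'I_#|B|.+1)
    = (Y \in [set Y : {set T} | Y \subset B & #|Y| == j]).
  rewrite inE; case: (boolP (Y \subset B)) => //= sYB.
  by rewrite -val_eqE /= inordK // ltnS subset_leq_card.
rewrite (eq_bigl _ _ eqP_j) (eq_bigr (fun=> f j)); last first.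
  by move=> Y; rewrite inE => /andP[_ /eqP->].
by rewrite sumr_const cards_draws mulr_natl.
Qed.

Lemma natr_bin (F : numFieldType) (i j : nat) :
  'C(i + j, j)%:R = (i + j)`!%:R / (i`!%:R * j`!%:R) :> F.
Proof.
have nz k : k`!%:R != 0 :> F by rewrite pnatr_eq0 -lt0n fact_gt0.
rewrite -(bin_fact (leq_addl i j)) addnK !natrM.
by field; rewrite !nz.
Qed.

(** With [i = k - a], [j = n - k] and [c = a - 1], no truncated subtraction occurs and both sides
    reduce to the same quotient of factorials. *)
Lemma bin_ratio (F : numFieldType) (i j c : nat) :
  'C(i + j, j)%:R * (c.+1%:R / ('C(i + c.+1 + j, j)%:R * (i + c.+1)%:R))
    = 'C(i + c, c)%:R / 'C(i + c.+1 + j, c.+1)%:R :> F.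
Proof.
have nz k : k`!%:R != 0 :> F by rewrite pnatr_eq0 -lt0n fact_gt0.
have nzS k : 1 + k%:R != 0 :> F by rewrite nat1r pnatr_eq0.
rewrite [in RHS]addnAC !natr_bin [(i + j + _)%N]addnAC addnS !factS !natrM.
field.
by rewrite !nz !nzS -natrD nzS.
Qed.

Lemma sum_superset (F : numFieldType) (T : finType) (A : {set T}) :
  A != set0 ->
  \sum_(X : {set T} | A \subset X)
     #|A|%:R / ('C(#|T|, #|X|)%:R * #|X|%:R) = 1 :> F.
Proof.
rewrite -card_gt0 => A_gt0.
(* Complements turn supersets of [A] into subsets of [~: A], which can be counted by size. *)
rewrite (reindex_inj (@setC_inj T)) /=.
under eq_bigl => Y do rewrite subsetC.
have cardCE (Y : {set T}) : #|~: Y| = (#|T| - #|Y|)%N by rewrite cardsCs setCK.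
under eq_bigr => Y _ do rewrite cardCE bin_sub ?max_card //.
rewrite (big_subset_card (~: A)
  (fun j => #|A|%:R / ('C(#|T|, j)%:R * (#|T| - j)%:R))).
have := cardsC A; case: #|A| A_gt0 => // c _; move: #|~: A| => b <-.
(* After reversal [i] is the size of [X] minus that of [A], the index of the hockey stick. *)
rewrite (reindex_inj rev_ord_inj) /=.
under eq_bigr => i _.
  have le_ib : (i <= b)%N by rewrite -ltnS.
  rewrite subSS.
  have -> : (c.+1 + b = i + c.+1 + (b - i))%N.
    by rewrite addnAC subnKC // addnC.
  rewrite addnK -{1}(subnKC le_ib) bin_ratio.
  (* The denominator no longer depends on [i], so it factors out of the sum. *)
  rewrite addnAC subnKC //.
  over.
rewrite -mulr_suml -natr_sum hockey_stick addnS divff //.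
by rewrite pnatr_eq0 -lt0n bin_gt0 ltnS leq_addl.
Qed.

Lemma card_lower_approx (T : finType) (P : {set {set T}}) (X : {set T}) :
  trivIset P -> #|lower_approx P X| = (\sum_(A in P | A \subset X) #|A|)%N.
Proof.
move=> tiP; pose Q := [set A in P | A \subset X].
have sQP : Q \subset P by apply/subsetP => A; rewrite inE => /andP[].
have QE A : (A \in P) && (A \subset X) = (A \in Q) by rewrite inE.
rewrite /lower_approx !(eq_bigl _ _ QE).
(* A subfamily of a disjoint family is disjoint, so sizes add up over [Q]. *)
by rewrite (eqP (trivIsetS sQP tiP)).
Qed.

Theorem mainTheorem4 (n m : nat) (P : {set {set 'I_n}})
    (hm : (2 <= m)%N) (hmn : (m < n)%N)
    (hP : partition P [set: 'I_n]) (hcard : #|P| = m) :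
  \sum_(X : {set 'I_n} | X != set0)
     (#|lower_approx P X|%:R / ('C(n, #|X|)%:R * #|X|%:R)) = m%:R :> rat.
Proof.
have [_ tiP P0] := and3P hP.
under eq_bigr => X _.
  rewrite card_lower_approx // natr_sum mulr_suml.
  over.
rewrite (exchange_big_dep (mem P)) /=; last by move=> X A _ /andP[].
rewrite -hcard -sumr_const; apply: eq_bigr => A PA.
have A0 : A != set0 by apply: contraNneq P0 => <-.
(* The condition [X != set0] is automatic once [X] contains the nonempty block [A]. *)
rewrite -[RHS](sum_superset rat A0) card_ord; apply: eq_bigl => X.
rewrite PA /=; case: (boolP (A \subset X)) => [sAX|_]; last by rewrite andbF.
by rewrite andbT; apply: contraNneq A0 => X0; rewrite -subset0 -X0.
Qed.
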